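(* There exists a constant $\overline{\lambda}>0$, independent of $\overline{\overline{\Omega}}$ and of $\delta$ (it may depend on the dimension $d$), such that whenever $\overline{\overline{\Omega}}\subset\mathbb{R}^d$ is bounded, $\delta>0$, and $u\in L_2(\overline{\overline{\Omega}})$, $$a(u,u)\le\overline{\lambda}\,\delta^d\,\|u\|^2_{L_2(\overline{\overline{\Omega}})}.$$
   Context: Functions are real-valued (scalar). Let $\delta>0$ (the horizon). The canonical kernel is $\chi_\delta(\mathbf{x}-\mathbf{x}')=1$ if $\|\mathbf{x}-\mathbf{x}'\|\le\delta$ (Euclidean norm) and $0$ otherwise. For a domain $\Omega\subset\mathbb{R}^d$, the nonlocal boundary is the region of thickness $\delta$ surrounding $\Omega$, $\mathcal{B}\Omega=\{\mathbf{x}\in\mathbb{R}^d\setminus\Omega:\operatorname{dist}(\mathbf{x},\Omega)\le\delta\}$, and the nonlocal closure is $\overline{\overline{\Omega}}:=\Omega\cup\mathcal{B}\Omega$. The bilinear form is $$a(u,v)=\frac12\int_{\overline{\overline{\Omega}}}\int_{\overline{\overline{\Omega}}}\chi_\delta(\mathbf{x}-\mathbf{x}')\,[u(\mathbf{x}')-u(\mathbf{x})]\,[v(\mathbf{x}')-v(\mathbf{x})]\,d\mathbf{x}'\,d\mathbf{x}.$$ *)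

(* Defs.v *)
From HB Require Import structures.
From mathcomp Require Import all_boot all_order all_algebra.
From mathcomp Require Import all_classical all_reals all_analysis.
Import Order.TTheory GRing.Theory Num.Theory numFieldNormedType.Exports.

Set Implicit Arguments.
Unset Strict Implicit.
Unset Printing Implicit Defensive.

Local Open Scope classical_set_scope.
Local Open Scope ring_scope.

(* R^d is 'rV[R]_d, with the library's topology. Its measurable sets are the
   product sigma-algebra, generated by the coordinates as the library does for
   n.-tuple; they are the Borel sets. *)
Section measurable_rV.
Variables (R : realType) (d : nat).

Definition coord_rV (i : 'I_d) (x : 'rV[R]_d) : R := x ord0 i.

Let rV_set0 : g_sigma_preimage coord_rV set0.
Proof. exact: sigma_algebra0. Qed.

Let rV_setC A : g_sigma_preimage coord_rV A -> g_sigma_preimage coord_rV (~` A).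
Proof. exact: sigma_algebraC. Qed.

Let rV_bigcup (F : (set 'rV[R]_d)^nat) :
  (forall i, g_sigma_preimage coord_rV (F i)) ->
  g_sigma_preimage coord_rV (\bigcup_i (F i)).
Proof. exact: sigma_algebra_bigcup. Qed.

HB.instance Definition _ :=
  @isMeasurable.Build (measure_tuple_display default_measure_display)
    'rV[R]_d (g_sigma_preimage coord_rV) rV_set0 rV_setC rV_bigcup.

Lemma measurable_coord_rV (i : 'I_d) :
  measurable_fun [set: 'rV[R]_d] (coord_rV i).
Proof.
move=> _ Y mY; rewrite setTI; apply: sub_sigma_algebra => /=.
rewrite -bigcup_seq/=; exists i => /=; first by rewrite mem_index_enum.
by exists Y => //; rewrite setTI.
Qed.

Lemma measurable_fun_rV d1 (T1 : measurableType d1) (f : T1 -> 'rV[R]_d) :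
  (forall i, measurable_fun [set: T1] (coord_rV i \o f)) ->
  measurable_fun [set: T1] f.
Proof.
move=> mf.
suff prefS : g_sigma_preimage (fun i => coord_rV i \o f) `<=` measurable.
  move=> _ A mA; apply: prefS.
  by rewrite (g_sigma_preimage_comp coord_rV f); exists A.
apply: smallest_sub; first exact: sigma_algebra_measurable.
rewrite -bigcup_seq/=; apply: bigcup_sub => i _ A [B mB <-].
exact: mf.
Qed.

End measurable_rV.

Section lebesgue_rV.
Variable R : realType.

Definition cons_rV d (p : measurableTypeR R * 'rV[R]_d) : 'rV[R]_d.+1 :=
  \row_i oapp (p.2 ord0) p.1 (unlift ord0 i).

Definition uncons_rV d (x : 'rV[R]_d.+1) : measurableTypeR R * 'rV[R]_d :=
  (x ord0 ord0, \row_i x ord0 (lift ord0 i)).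

Lemma cons_rVK d : cancel (@cons_rV d) (@uncons_rV d).
Proof.
move=> [a x]; congr pair; first by rewrite mxE unlift_none.
by apply/rowP => i; rewrite !mxE liftK.
Qed.

Lemma measurable_cons_rV d : measurable_fun setT (@cons_rV d).
Proof.
apply: measurable_fun_rV => i; have [j ->|->] := unliftP ord0 i.
- rewrite (_ : _ \o _ = coord_rV j \o snd).
    exact: measurableT_comp (measurable_coord_rV j) measurable_snd.
  by apply/funext => x /=; rewrite /coord_rV mxE liftK.
- rewrite (_ : _ \o _ = fst); first exact: measurable_fst.
  by apply/funext => x /=; rewrite /coord_rV mxE unlift_none.
Qed.

Lemma measurable_uncons_rV d : measurable_fun setT (@uncons_rV d).
Proof.
apply/measurable_fun_pair; first exact: (measurable_coord_rV ord0).
apply: measurable_fun_rV => i.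
rewrite (_ : _ \o _ = coord_rV (lift ord0 i)); first exact: measurable_coord_rV.
by apply/funext => x /=; rewrite /coord_rV mxE.
Qed.

(* The product of one-dimensional Lebesgue measure with a measure on R^d,
   carried to R^(d+1). *)
Definition lebesgue_step d (mu : {sigma_finite_measure set 'rV[R]_d -> \bar R})
    : set 'rV[R]_d.+1 -> \bar R :=
  pushforward (@lebesgue_measure R \x mu)%E (@cons_rV d).

Section lebesgue_step.
Variables (d : nat) (mu : {sigma_finite_measure set 'rV[R]_d -> \bar R}).

HB.instance Definition _ := Measure.copy (lebesgue_step mu)
  (measure_function_pushforward__canonical__measure_function_Measure
    (@lebesgue_measure R \x mu)%E (@measurable_cons_rV d)).

Let step_sigma_finite : sigma_finite setT (lebesgue_step mu).
Proof.
have /sigma_finiteP[F [FT ndF Foo]] := sigma_finiteT (@lebesgue_measure R).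
have /sigma_finiteP[G [GT ndG Goo]] := sigma_finiteT mu.
exists (fun n => @uncons_rV d @^-1` (F n `*` G n)).
  rewrite -preimage_bigcup -[LHS](preimage_setT (@uncons_rV d)); congr preimage.
  apply/seteqP; split=> // -[x y] _.
  have [m _ Fmx] : (\bigcup_k F k) x by rewrite -FT.
  have [n _ Gny] : (\bigcup_k G k) y by rewrite -GT.
  exists (maxn m n) => //; split.
    by move: x Fmx; exact/subsetPset/ndF/leq_maxl.
  by move: y Gny; exact/subsetPset/ndG/leq_maxr.
move=> n; have [mFn Fn] := Foo n; have [mGn Gn] := Goo n; split.
  rewrite -[X in measurable X]setTI; apply: measurable_uncons_rV => //.
  exact: measurableX.
rewrite /lebesgue_step /pushforward -comp_preimage.
rewrite (_ : _ \o _ = id); last by apply/funext => x; exact: cons_rVK.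
by rewrite [ltLHS]product_measure1E// lte_mul_pinfty// ge0_fin_numE.
Qed.

HB.instance Definition _ := Measure_isSigmaFinite.Build _ _ _
  (lebesgue_step mu) step_sigma_finite.

End lebesgue_step.

(* The d-fold product of one-dimensional Lebesgue measure; the unit mass on the
   one-point space R^0. *)
Fixpoint lebesgue_rV (d : nat) : {sigma_finite_measure set 'rV[R]_d -> \bar R} :=
  if d is d'.+1 then lebesgue_step (lebesgue_rV d') else \d_(0 : 'rV[R]_0).

End lebesgue_rV.

Section nonlocal.
Variables (R : realType) (d : nat).
Implicit Types (x : 'rV[R]_d) (Omega D : set 'rV[R]_d) (u v : 'rV[R]_d -> R).

Definition is_domain Omega := [/\ open Omega, connected Omega & Omega !=set0].

(* The library's norm on 'rV[R]_d is the sup norm. *)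
Definition enorm x : R := Num.sqrt (\sum_(i < d) x ord0 i ^+ 2).

(* Meaningful for Omega !=set0 only, as inf set0 = 0. *)
Definition dist x Omega : R := inf [set enorm (x - y) | y in Omega].

Definition nonlocal_boundary (delta : R) Omega : set 'rV[R]_d :=
  [set x | ~ Omega x /\ dist x Omega <= delta].

Definition nonlocal_closure (delta : R) Omega : set 'rV[R]_d :=
  Omega `|` nonlocal_boundary delta Omega.

Definition chi (delta : R) x : R := if enorm x <= delta then 1 else 0.

(* Extended-real valued, so that the iterated integral needs no a priori
   finiteness. D stands for the nonlocal closure. *)
Definition bilinear_form (delta : R) D u v : \bar R :=
  ((2^-1)%:E * \int[lebesgue_rV R d]_(x in D) \int[lebesgue_rV R d]_(x' in D)
     (chi delta (x - x') * (u x' - u x) * (v x' - v x))%:E)%E.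

(* L_2(D) and its norm, through extension by zero outside D. *)
Definition in_L2 D u : Prop := u \_ D \in Lfun (lebesgue_rV R d) 2%:E.

Definition L2norm D u : \bar R := ('N[lebesgue_rV R d]_2%:E[EFin \o (u \_ D)])%E.

End nonlocal.

(* Main.v *)
(* Expanding (u(x') - u(x))^2 <= 2 u(x)^2 + 2 u(x')^2 and exchanging the
   integrals in the second term by Tonelli, each of the two terms contributes
   the integral of 2 u(x)^2 times the volume of the delta-ball around x, which
   lies in a cube of volume (2 delta)^d. *)

Require Import Defs.
From mathcomp Require Import all_boot all_order all_algebra.
From mathcomp Require Import all_classical all_reals all_analysis.
From mathcomp Require Import measurable_realfun ring lra.
Import Order.TTheory GRing.Theory Num.Theory numFieldNormedType.Exports.

Set Implicit Arguments.
Unset Strict Implicit.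
Unset Printing Implicit Defensive.

Local Open Scope classical_set_scope.
Local Open Scope ring_scope.

(* Unlike in ge0_le_integral, nothing has to be measurable: the integral of a
   nonnegative function is a supremum over the simple functions below it. This
   avoids proving that the nonlocal closure is measurable. *)
Lemma ge0_le_integral_dom disp (T : measurableType disp) (R : realType)
    (mu : {measure set T -> \bar R}) (D : set T) (f g : T -> \bar R) :
  (forall x, D x -> 0 <= f x)%E -> (forall x, 0 <= g x)%E ->
  (forall x, D x -> f x <= g x)%E ->
  (\int[mu]_(x in D) f x <= \int[mu]_x g x)%E.
Proof.
move=> f0 g0 fg; rewrite ge0_integralE// ge0_integralTE//.
apply: ereal_sup_le => _ [h /= hf <-]; exists h => //= x.
apply: le_trans (hf x) _; rewrite patchE.
by case: ifPn => [/set_mem /fg|].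
Qed.

Section cube.
Variables (R : realType) (d : nat).
Implicit Types (x y : 'rV[R]_d) (delta : R).

(** The closed sup-norm ball, which stands in for the Euclidean ball: as a product of intervals it
    has an explicit volume and is cut out by coordinate conditions. *)
Definition cube delta x : set 'rV[R]_d :=
  [set y | forall i, `|x ord0 i - y ord0 i| <= delta].

Lemma cube_sym delta x y : cube delta x y = cube delta y x.
Proof. by apply/propext; split=> h i; rewrite distrC. Qed.

(** Each squared coordinate is at most the sum of all of them. *)
Lemma enorm_cube delta x y : enorm (x - y) <= delta -> cube delta x y.
Proof.
move=> xy i; apply: le_trans xy.
rewrite /enorm -sqrtr_sqr ler_wsqrtr// (bigD1 i)//= !mxE lerDl.
by apply: sumr_ge0 => j _; exact: sqr_ge0.
Qed.

(** Tonelli's theorem will need measurability jointly in both points. The set is a finite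
    intersection of preimages of [[- delta, delta]] under coordinate differences. *)
Lemma measurable_cube_pair delta :
  measurable [set p : 'rV[R]_d * 'rV[R]_d | cube delta p.1 p.2].
Proof.
rewrite (_ : [set _ | _] = \bigcap_(i in [set: 'I_d])
    ((fun p : 'rV[R]_d * 'rV[R]_d => coord_rV i p.1 - coord_rV i p.2)
       @^-1` `[- delta, delta])); last first.
  apply/seteqP; split=> p /= h i.
    by move=> _; rewrite /= in_itv/= -ler_norml; exact: h.
  by have := h i Logic.I; rewrite /= in_itv/= -ler_norml.
apply: fin_bigcap_measurable; first exact: finite_finset.
move=> i _; rewrite -[X in measurable X]setTI.
suff : measurable_fun setT
    (fun p : 'rV[R]_d * 'rV[R]_d => coord_rV i p.1 - coord_rV i p.2).
  by apply => //; exact: measurable_itv.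
apply: measurable_funB.
- exact: measurableT_comp (measurable_coord_rV i) measurable_fst.
- exact: measurableT_comp (measurable_coord_rV i) measurable_snd.
Qed.

Lemma measurable_cube delta x : measurable (cube delta x).
Proof.
have := measurable_xsection x (measurable_cube_pair delta).
by congr measurable; apply/seteqP; split=> y; rewrite /xsection/= inE.
Qed.

End cube.
Arguments measurable_cube {R d}.
Arguments measurable_cube_pair {R d}.

(** Induction on [d]: through [cons_rV] the cube becomes an interval times a cube of one dimension
    less, and the measure is a product. *)
Lemma lebesgue_cube (R : realType) (d : nat) (delta : R) (x : 'rV[R]_d) :
  0 <= delta -> lebesgue_rV R d (cube delta x) = ((2 * delta) ^+ d)%:E.
Proof.
move=> delta0; elim: d x => [|d IH] x.
  by rewrite /= diracE mem_set// => -[].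
rewrite /= /lebesgue_step /pushforward.
set a := (uncons_rV x).1; set x' := (uncons_rV x).2.
rewrite (_ : _ @^-1` _ = `[a - delta, a + delta] `*` cube delta x');
  last first.
  apply/seteqP; split=> -[b y] /=.
    move=> h; split=> /=.
      have := h ord0; rewrite /cons_rV mxE unlift_none/= in_itv/=.
      by rewrite distrC ler_distl.
    by move=> i; have := h (lift ord0 i); rewrite !mxE liftK.
  rewrite in_itv/= -ler_distl distrC => -[ab h] i.
  have [j ->|->] := unliftP ord0 i; last by rewrite mxE unlift_none.
  by have := h j; rewrite !mxE liftK.
rewrite product_measure1E//; last exact: measurable_cube.
rewrite IH [X in (X * _)%E]lebesgue_measure_itv/= lte_fin.
case: ifPn => [_|]; first by rewrite -EFinD -EFinM exprS; congr (_ * _)%:E; ring.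
(* The interval formula gives 0 unless the endpoints are strictly ordered. Failing that,
   [delta = 0], and the right-hand side vanishes too because its exponent is [d.+1]. *)
rewrite -leNgt => h; have -> : delta = 0 by apply/eqP; rewrite eq_le delta0; lra.
by rewrite mul0e mulr0 expr0n.
Qed.

Section cube_integral.
Variables (R : realType) (d : nat).
Local Notation mu := (lebesgue_rV R d).
Variables (delta : R) (f : 'rV[R]_d -> \bar R).
Hypotheses (delta0 : 0 <= delta) (mf : measurable_fun setT f).
Hypothesis f0 : forall x, (0 <= f x)%E.

Lemma measurable_indic_cube_pair :
  measurable_fun setT (fun p : 'rV[R]_d * 'rV[R]_d =>
    (\1_(cube delta p.1) p.2)%:E : \bar R).
Proof.
apply/measurable_EFinP.
rewrite (_ : (fun _ => _) =
    \1_[set p : 'rV[R]_d * 'rV[R]_d | cube delta p.1 p.2]).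
  by apply: measurable_indic; exact: measurable_cube_pair.
by apply/funext => p; rewrite !indicE; congr (nat_of_bool _)%:R.
Qed.

Lemma measurable_cube_mul1 :
  measurable_fun setT (fun p : 'rV[R]_d * 'rV[R]_d =>
    (\1_(cube delta p.1) p.2)%:E * f p.1)%E.
Proof.
apply: emeasurable_funM; first exact: measurable_indic_cube_pair.
exact: measurableT_comp mf measurable_fst.
Qed.

Lemma measurable_cube_mul2 :
  measurable_fun setT (fun p : 'rV[R]_d * 'rV[R]_d =>
    (\1_(cube delta p.1) p.2)%:E * f p.2)%E.
Proof.
apply: emeasurable_funM; first exact: measurable_indic_cube_pair.
exact: measurableT_comp mf measurable_snd.
Qed.

(** [f x] is constant in the inner variable and leaves the volume of the cube, the same for every
    centre. *)
Lemma integral_cube1 :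
  (\int[mu]_x \int[mu]_y ((\1_(cube delta x) y)%:E * f x) =
   ((2 * delta) ^+ d)%:E * \int[mu]_x f x)%E.
Proof.
rewrite -ge0_integralZl// ?lee_fin ?exprn_ge0 ?mulr_ge0//.
apply: eq_integral => x _; rewrite ge0_integralZr//.
- rewrite integral_indic ?setIT//; last exact: measurable_cube.
  by congr (_ * _)%E; exact: lebesgue_cube.
- by apply/measurable_EFinP; apply: measurable_indic; exact: measurable_cube.
Qed.

(** Tonelli's theorem swaps the integrals, and the symmetry of [cube] reduces the result to
    [integral_cube1]. *)
Lemma integral_cube2 :
  (\int[mu]_x \int[mu]_y ((\1_(cube delta x) y)%:E * f y) =
   ((2 * delta) ^+ d)%:E * \int[mu]_x f x)%E.
Proof.
rewrite -integral_cube1.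
rewrite [RHS](fubini_tonelli
  (fun p => (\1_(cube delta p.1) p.2)%:E * f p.1)%E measurable_cube_mul1).
  apply: eq_integral => x _; apply: eq_integral => y _.
  rewrite /= !indicE; congr ((nat_of_bool _)%:R%:E * _)%E.
  by apply/idP/idP; rewrite !inE cube_sym.
by move=> p; rewrite mule_ge0// lee_fin.
Qed.

Lemma integral_cubeD :
  (\int[mu]_x \int[mu]_y
     ((\1_(cube delta x) y)%:E * f x + (\1_(cube delta x) y)%:E * f y) =
   (2 * (2 * delta) ^+ d)%:E * \int[mu]_x f x)%E.
Proof.
under eq_integral => x _.
  rewrite ge0_integralD//; first over.
  - by move=> y _; rewrite mule_ge0// lee_fin.
  - exact: measurableT_comp measurable_cube_mul1 (measurable_pair1 x).
  - by move=> y _; rewrite mule_ge0// lee_fin.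
  - exact: measurableT_comp measurable_cube_mul2 (measurable_pair1 x).
rewrite ge0_integralD//; last 4 first.
- by move=> x _; apply: integral_ge0 => y _; rewrite mule_ge0// lee_fin.
(* Tonelli's theorem also gives the measurability in [x] of the inner integrals. *)
- apply: (measurable_fun_fubini_tonelli_F _ measurable_cube_mul1).
  by move=> p; rewrite mule_ge0// lee_fin.
- by move=> x _; apply: integral_ge0 => y _; rewrite mule_ge0// lee_fin.
- apply: (measurable_fun_fubini_tonelli_F _ measurable_cube_mul2).
  by move=> p; rewrite mule_ge0// lee_fin.
rewrite integral_cube1 integral_cube2.
rewrite -ge0_muleDl ?lee_fin ?exprn_ge0 ?mulr_ge0// -EFinD.
by congr (_%:E * _)%E; ring.
Qed.

End cube_integral.

Lemma L2norm_sqr (R : realType) (d : nat) (D : set 'rV[R]_d)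
    (u : 'rV[R]_d -> R) :
  (L2norm D u ^+ 2 = \int[lebesgue_rV R d]_x ((u \_ D) x ^+ 2)%:E)%E.
Proof.
(* The root cancels against a real power, so the integer square is converted first; the norm may be
   [+oo] here. *)
transitivity (L2norm D u `^ 2)%E.
  have : (0 <= L2norm D u)%E by exact: Lnorm_ge0.
  case: (L2norm D u) => [r|_|//]; last by rewrite /= mulyy pnatr_eq0.
  by rewrite lee_fin => r0; rewrite /= powR_mulrn.
rewrite poweR_Lnorm//.
by apply: eq_integral => x _ /=; rewrite powR_mulrn// -normrX ger0_norm ?sqr_ge0.
Qed.

Theorem lemma1 (R : realType) (d : nat) :
  exists lambda : R, 0 < lambda /\
    forall (delta : R) (Omega : set 'rV[R]_d) (u : 'rV[R]_d -> R),
      0 < delta ->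
      is_domain Omega ->
      bounded_set (nonlocal_closure delta Omega) ->
      in_L2 (nonlocal_closure delta Omega) u ->
      (bilinear_form delta (nonlocal_closure delta Omega) u u <=
         (lambda * delta ^+ d)%:E * L2norm (nonlocal_closure delta Omega) u ^+ 2)%E.
Proof.
(* The factor 1/2 of the form meets a 2 from the square inequality and another from the two equal
   terms; [2 ^+ d] comes from the volume of the cube. *)
exists (2 * 2 ^+ d); split; first by rewrite mulr_gt0// exprn_gt0.
move=> delta Omega u delta0 _ _; set D := nonlocal_closure _ _.
rewrite L2norm_sqr => /sub_Lfun_mfun; rewrite inE/= => mU.
set U := u \_ D in mU *.
(* Built on the extension by zero, so that the bound can be integrated over the whole space. *)
pose f x : \bar R := (2 * U x ^+ 2)%:E.
have mf : measurable_fun setT f.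
  by apply/measurable_EFinP; apply: measurable_funM => //; exact: measurable_funX.
have f0 x : (0 <= f x)%E by rewrite lee_fin mulr_ge0// sqr_ge0.
pose G x y :=
  ((\1_(cube delta x) y)%:E * f x + (\1_(cube delta x) y)%:E * f y)%E.
have G0 x y : (0 <= G x y)%E by rewrite adde_ge0// mule_ge0.
apply: (@le_trans _ _ ((2^-1)%:E * \int[lebesgue_rV R d]_x
    \int[lebesgue_rV R d]_y G x y)%E).
  apply: lee_wpmul2l; first by rewrite lee_fin.
  have inner0 x y : (0 <= (chi delta (x - y) * (u y - u x) * (u y - u x))%:E)%E.
    rewrite lee_fin -mulrA mulr_ge0 -?expr2 ?sqr_ge0// /chi.
    by case: ifP.
  (* Pass from [D] to the whole space, here in the outer integral and next in the inner one. *)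
  apply: ge0_le_integral_dom => [x _|x|x Dx]; try exact: integral_ge0.
  apply: ge0_le_integral_dom => // y Dy.
  rewrite /G /f -EFinM -EFinM -EFinD lee_fin /U !patchE !mem_set// /chi indicE.
  (* Beyond the horizon the integrand is 0; within it, the indicator of the cube is 1. *)
  case: ifPn => [xy|_]; last first.
    rewrite !mul0r; apply: addr_ge0; apply: mulr_ge0 => //;
      by apply: mulr_ge0 => //; exact: sqr_ge0.
  rewrite mem_set ?mul1r; last exact: enorm_cube.
  (* 2 a^2 + 2 b^2 - (a - b)^2 = (a + b)^2 *)
  have := sqr_ge0 (u y + u x); rewrite !expr2; lra.
rewrite (integral_cubeD (ltW delta0) mf f0) /f.
under [X in (_ * (_ * X))%E]eq_integral do rewrite EFinM.
rewrite ge0_integralZl//; last 2 first.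
- by apply/measurable_EFinP; exact: measurable_funX.
- by move=> x _; rewrite lee_fin sqr_ge0.
rewrite !muleA -!EFinM exprMn.
rewrite le_eqVlt; apply/orP; left; apply/eqP.
by congr (_%:E * _)%E; field.
Qed.
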